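(* Let $n\ge1$ and let $f:\mathbb{R}^{n+1}\to\mathbb{R}$ be the strictly convex quadratic $f(x)=\tfrac12 x^\top A x+b^\top x+c$, with $A$ symmetric positive definite, $b\in\mathbb{R}^{n+1}$, $c\in\mathbb{R}$. For any $x$ with $\nabla f(x)\ne 0$, the affine normal direction $d_{\mathrm{AN}}(x)$ of the level set $\{y: f(y)=f(x)\}$ is collinear with the Newton direction $d_{\mathrm{N}}(x)=-(\nabla^2f(x))^{-1}\nabla f(x)=-A^{-1}\nabla f(x)$; that is, there exists $\lambda(x)>0$ such that $$d_{\mathrm{AN}}(x)=\lambda(x)\,d_{\mathrm{N}}(x).$$ When $\nabla f(x)=0$, both vanish.
   Context: Affine normal direction: at a point $x$ with $\nabla f(x)\neq0$ put $e_{n+1}=\nabla f(x)/\|\nabla f(x)\|$ and let $e_1,\dots,e_n$ be an orthonormal basis of $\nabla f(x)^\perp$. For $i,j,p,q\in\{1,\dots,n\}$ write $f_{ij}=D^2f(x)[e_i,e_j]$, $f_{n+1,i}=D^2f(x)[e_{n+1},e_i]$, $f_{pqi}=D^3f(x)[e_p,e_q,e_i]$, and let $(f^{ij})$ be the inverse matrix of $(f_{ij})_{1\le i,j\le n}$. Then $d_{\mathrm{AN}}(x)$ is, up to a positive scalar, $$\sum_{i=1}^n\Big(\sum_{j=1}^n f^{ij}\Big(-\tfrac{1}{n+2}\|\nabla f(x)\|\sum_{p,q=1}^n f^{pq}f_{pqj}+f_{n+1,j}\Big)\Big)e_i-e_{n+1}.$$ When $\nabla f(x)=0$, the convention is $d_{\mathrm{AN}}(x)=0$.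 *)

(* Defs.v *)
From HB Require Import structures.
From mathcomp Require Import all_boot all_order all_algebra.
From mathcomp Require Import all_classical all_reals all_analysis.
From mathcomp Require Import ring.

Set Implicit Arguments.
Unset Strict Implicit.
Unset Printing Implicit Defensive.

Import Order.TTheory GRing.Theory Num.Theory.
Import numFieldNormedType.Exports.

Local Open Scope ring_scope.

(* The library norm on matrices is the sup norm, hence an explicit Euclidean
   inner product and norm. *)
Definition dotv (R : realType) (m : nat) (u v : 'cV[R]_m) : R :=
  (u^T *m v) 0 0.

Definition enorm (R : realType) (m : nat) (u : 'cV[R]_m) : R :=
  Num.sqrt (dotv u u).

Definition pos_def (R : realType) (m : nat) (A : 'M[R]_m) : Prop :=
  forall v : 'cV[R]_m, v != 0 -> 0 < dotv v (A *m v).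

Definition quadratic (R : realType) (m : nat) (A : 'M[R]_m) (b : 'cV[R]_m)
    (c : R) (x : 'cV[R]_m) : R :=
  2^-1 * dotv x (A *m x) + dotv b x + c.

Section Derivatives.
Variables (R : realType) (m : nat).
Implicit Types (f : 'cV[R]_m.+1 -> R) (x u v w : 'cV[R]_m.+1).

Definition D2 f x u v : R := 'D_u (fun y => 'D_v f y) x.

Definition D3 f x u v w : R := 'D_u (fun y => D2 f y v w) x.

Definition grad f x : 'cV[R]_m.+1 := \col_i 'D_(delta_mx i 0) f x.

Definition hessian f x : 'M[R]_m.+1 :=
  \matrix_(i, j) D2 f x (delta_mx i 0) (delta_mx j 0).

Definition newton_direction f x : 'cV[R]_m.+1 :=
  - (invmx (hessian f x) *m grad f x).

End Derivatives.

Section AffineNormal.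
Variables (R : realType) (n : nat).
Implicit Types (f : 'cV[R]_n.+1 -> R) (x d g : 'cV[R]_n.+1).
Implicit Types e : 'I_n -> 'cV[R]_n.+1.

(* For g != 0, e is an orthonormal basis of the orthogonal complement of g:
   it spans since that complement has dimension n. *)
Definition orthonormal_frame g e : Prop :=
  (forall i j, dotv (e i) (e j) = (i == j)%:R) /\ (forall i, dotv (e i) g = 0).

Definition unit_normal f x : 'cV[R]_n.+1 := (enorm (grad f x))^-1 *: grad f x.

Definition tangent_hessian f x e : 'M[R]_n := \matrix_(i, j) D2 f x (e i) (e j).

Definition affine_normal_vector f x e : 'cV[R]_n.+1 :=
  let finv := invmx (tangent_hessian f x e) in
  \sum_i (\sum_j finv i j *
            (- (n.+2%:R^-1 * enorm (grad f x) *
                \sum_p \sum_q finv p q * D3 f x (e p) (e q) (e j))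
             + D2 f x (unit_normal f x) (e j))) *: e i
  - unit_normal f x.

(* The affine normal direction is only defined up to a positive scalar; the
   predicate holds of every representative d, in any orthonormal frame. *)
Definition is_affine_normal_direction f x d : Prop :=
  if grad f x == 0 then d = 0
  else exists e, orthonormal_frame (grad f x) e /\
       exists2 mu : R, 0 < mu & d = mu *: affine_normal_vector f x e.

(* Householder reflection exchanging the first basis vector and g / |g|. *)
Lemma orthonormal_frame_exists g : g != 0 -> exists e, orthonormal_frame g e.
Proof.
move=> g0.
have dotE k (u v : 'cV[R]_k) : dotv u v = \sum_i u i 0 * v i 0.
  by rewrite /dotv mxE; apply: eq_bigr => i _; rewrite mxE.
have dot_gt0 k (u : 'cV[R]_k) : u != 0 -> 0 < dotv u u.
  move=> u0; rewrite lt_neqAle eq_sym; apply/andP; split; last first.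
    by rewrite dotE sumr_ge0 // => i _; rewrite -expr2 sqr_ge0.
  apply: contra u0; rewrite dotE psumr_eq0 => [/allP h|i _]; last first.
    by rewrite -expr2 sqr_ge0.
  apply/eqP/matrixP => i j; rewrite (ord1 j) mxE.
  by have := h i (mem_index_enum _); rewrite /= mulf_eq0 orbb => /eqP.
have scal (k : nat) (u v : 'cV[R]_k) : u^T *m v = (dotv u v)%:M.
  by rewrite [LHS]mx11_scalar.
pose s := enorm g; have s0 : s != 0 by rewrite gt_eqF // sqrtr_gt0 dot_gt0.
pose u := s^-1 *: g; pose d0 : 'cV[R]_n.+1 := delta_mx 0 0.
have uu : dotv u u = 1.
  have ss : dotv g g = s * s by rewrite -expr2 sqr_sqrtr // ltW // dot_gt0.
  have -> : dotv u u = s^-1 * (s^-1 * dotv g g).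
    by rewrite !dotE !mulr_sumr; apply: eq_bigr => i _; rewrite !mxE; ring.
  by rewrite ss mulKf // mulVf.
have dd : dotv d0 d0 = 1 by rewrite /dotv trmx_delta mul_delta_mx mxE !eqxx.
have [H [HT HH Hd]] : exists H : 'M[R]_n.+1, [/\ H^T = H, H *m H = 1%:M
    & H *m d0 = u].
  have [ud|ud] := eqVneq u d0.
    by exists 1%:M; rewrite trmx1 !mul1mx ud.
  pose w := u - d0; have w0 : w != 0 by rewrite subr_eq0.
  have ww := dot_gt0 _ _ w0; set a := dotv w w in ww.
  exists (1%:M - (2 / a) *: (w *m w^T)); split.
  - by rewrite linearB /= trmx1 linearZ /= trmx_mul trmxK.
  - have P2 : (w *m w^T) *m (w *m w^T) = a *: (w *m w^T).
      by rewrite mulmxA -(mulmxA w) scal mul_mx_scalar -scalemxAl.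
    rewrite mulmxBl mul1mx mulmxBr mulmx1 -scalemxAl -scalemxAr P2.
    rewrite [(2 / a) *: (a *: _)]scalerA divfK ?gt_eqF // scaler_nat -scalerMnr.
    by rewrite mulr2n opprB addrK subrK.
  have ud0 : dotv d0 u = dotv u d0.
    by rewrite !dotE; apply: eq_bigr => i _; rewrite mulrC.
  have dw : dotv w d0 = - a / 2.
    have BE : dotv w d0 = dotv u d0 - 1.
      by rewrite -dd /dotv linearB /= mulmxBl mxE [in X in _ + X]mxE.
    have -> : a = 2 * (1 - dotv u d0); last first.
      by rewrite BE mulrC mulrN mulKf ?pnatr_eq0 // opprB.
    have -> : a = dotv w u - dotv w d0.
      by rewrite /a {2}/w /dotv mulmxBr mxE [in X in _ + X]mxE.
    have -> : dotv w u = 1 - dotv u d0.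
      by rewrite -ud0 -uu /dotv linearB /= mulmxBl mxE [in X in _ + X]mxE.
    by rewrite BE opprB mulr_natl mulr2n.
  have aN : (2 / a) * (- a / 2) = -1 by field; rewrite gt_eqF.
  rewrite mulmxBl mul1mx -scalemxAl -mulmxA scal dw mul_mx_scalar scalerA aN.
  by rewrite scaleN1r opprK /w addrC subrK.
have HE (k l : 'I_n.+1) :
    dotv (H *m delta_mx k 0) (H *m delta_mx l 0) = (k == l)%:R.
  rewrite /dotv trmx_mul HT mulmxA -(mulmxA _ H H) HH mulmx1 trmx_delta.
  by rewrite mul_delta_mx_cond; case: eqP => _; rewrite ?mulr1n ?mulr0n mxE ?eqxx.
exists (fun i => H *m delta_mx (lift ord0 i) 0); split=> [i j|i].
  by rewrite HE (inj_eq lift_inj).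
have -> : g = s *: u by rewrite scalerA divff // scale1r.
rewrite -Hd /dotv -scalemxAr mxE [X in _ * X](HE _ 0).
by rewrite eq_sym (negbTE (neq_lift _ _)) mulr0.
Qed.

Lemma affine_normal_direction_exists f x :
  exists d, is_affine_normal_direction f x d.
Proof.
rewrite /is_affine_normal_direction; case: eqVneq => [_|g0]; first by exists 0.
have [e he] := orthonormal_frame_exists g0.
by exists (1 *: affine_normal_vector f x e), e; split => //; exists 1.
Qed.

End AffineNormal.

(* Main.v *)
(** Write [g] for the gradient [A x + b], [N = g / |g|], and [E] for the matrix
    whose columns are the frame.  Third derivatives vanish, so the affine normal
    is [d = E (E^T A E)^-1 E^T A N - N].  Hence [E^T A d = 0]: the vector [A d]
    is orthogonal to [g^\perp], i.e. [A d = t N], and [d . N = -1] gives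
    [t = - d . A d < 0].  So [d] is a positive multiple of [- A^-1 g]. *)
Require Import Defs.
From HB Require Import structures.
From mathcomp Require Import all_boot all_order all_algebra.
From mathcomp Require Import all_classical all_reals all_analysis.
From mathcomp Require Import ring.

Set Implicit Arguments.
Unset Strict Implicit.
Unset Printing Implicit Defensive.

Import Order.TTheory GRing.Theory Num.Theory.
Import numFieldNormedType.Exports.

Local Open Scope ring_scope.

(** * Euclidean inner product and positive definite matrices *)

Section DotProduct.
Variable R : realType.

Lemma trmx_mul_dotv m (u v : 'cV[R]_m) : u^T *m v = (dotv u v)%:M.
Proof. exact: mx11_scalar. Qed.

Lemma dotvE m (u v : 'cV[R]_m) : dotv u v = \sum_i u i 0 * v i 0.
Proof. by rewrite /dotv mxE; apply: eq_bigr => i _; rewrite mxE. Qed.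

Lemma dotvC m (u v : 'cV[R]_m) : dotv u v = dotv v u.
Proof. by rewrite !dotvE; apply: eq_bigr => i _; rewrite mulrC. Qed.

Lemma dotvDr m (u v w : 'cV[R]_m) : dotv u (v + w) = dotv u v + dotv u w.
Proof. by rewrite /dotv mulmxDr mxE. Qed.

Lemma dotvZr m a (u v : 'cV[R]_m) : dotv u (a *: v) = a * dotv u v.
Proof. by rewrite /dotv -scalemxAr mxE. Qed.

Lemma dotvDl m (u v w : 'cV[R]_m) : dotv (u + v) w = dotv u w + dotv v w.
Proof. by rewrite dotvC dotvDr !(dotvC w). Qed.

Lemma dotvZl m a (u v : 'cV[R]_m) : dotv (a *: u) v = a * dotv u v.
Proof. by rewrite dotvC dotvZr dotvC. Qed.

Lemma dotv0 m (u : 'cV[R]_m) : dotv u 0 = 0.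
Proof. by rewrite /dotv mulmx0 mxE. Qed.

Lemma dotv_mulmx m k (M : 'M[R]_(m, k)) u v :
  dotv u (M *m v) = dotv (M^T *m u) v.
Proof. by rewrite /dotv trmx_mul trmxK mulmxA. Qed.

Lemma dotv_gt0 m (u : 'cV[R]_m) : u != 0 -> 0 < dotv u u.
Proof.
move=> u0; have uu0 : 0 <= dotv u u.
  by rewrite dotvE sumr_ge0 // => i _; rewrite -expr2 sqr_ge0.
rewrite lt_def uu0 andbT; apply: contra u0; rewrite dotvE psumr_eq0.
  move=> /allP h; apply/eqP/matrixP => i j; rewrite (ord1 j) mxE.
  by have := h i (mem_index_enum _); rewrite /= mulf_eq0 orbb => /eqP.
by move=> i _; rewrite -expr2 sqr_ge0.
Qed.

Lemma enorm_gt0 m (u : 'cV[R]_m) : u != 0 -> 0 < enorm u.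
Proof. by move=> u0; rewrite sqrtr_gt0 dotv_gt0. Qed.

Lemma enorm_sqr m (u : 'cV[R]_m) : u != 0 -> dotv u u = enorm u ^+ 2.
Proof. by move=> u0; rewrite sqr_sqrtr // ltW // dotv_gt0. Qed.

(** [kermx] is a left kernel, so it is taken of [M^T]: the transpose of a nonzero row of it would be
    a nonzero vector killed by [M], against positivity. *)
Lemma pos_def_unitmx m (M : 'M[R]_m) : pos_def M -> M \in unitmx.
Proof.
move=> Mpos; rewrite -unitmx_tr -row_free_unit -kermx_eq0.
apply/eqP/row_matrixP => i; rewrite row0; apply/eqP/negPn/negP => r0.
have Mr0 : M *m (row i (kermx M^T))^T = 0.
  apply: trmx_inj; rewrite trmx_mul trmxK trmx0.
  by apply/sub_kermxP/row_sub.
have /Mpos : (row i (kermx M^T))^T != 0 by rewrite -trmx0 (inj_eq trmx_inj).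
by rewrite Mr0 dotv0 ltxx.
Qed.

(** The form at [v] is that of [M] at [E v], and [E] is injective because [E^T] is a left
    inverse. *)
Lemma pos_def_congr m k (M : 'M[R]_m) (E : 'M[R]_(m, k)) :
  E^T *m E = 1%:M -> pos_def M -> pos_def (E^T *m M *m E).
Proof.
move=> EE Mpos v v0.
have -> : dotv v (E^T *m M *m E *m v) = dotv (E *m v) (M *m (E *m v)).
  by rewrite -!mulmxA dotv_mulmx trmxK.
apply: Mpos; apply: contra v0 => /eqP Ev0.
by rewrite -[v]mul1mx -EE -mulmxA Ev0 mulmx0.
Qed.

End DotProduct.

(** * Directional derivatives of a quadratic *)

Section QuadraticDerivatives.
Local Open Scope classical_set_scope.
Variables (R : realType) (m : nat).
Implicit Types (x u v w y : 'cV[R]_m.+1).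

(** For [h != 0] the difference quotient is exactly [p + h * q], which tends to [p]; each derivative
    then reduces to an expansion in [h]. *)
Lemma derive_quadratic_along (f : 'cV[R]_m.+1 -> R) x v (p q : R) :
  (forall h, f (h *: v + x) = f x + h * p + h ^+ 2 * q) -> 'D_v f x = p.
Proof.
move=> fE; apply: cvg_lim => //.
have pq : (fun h : R => p + h * q) @ 0^' --> p + 0 * q.
  by apply: cvg_within_filter; apply: cvgD; [exact: cvg_cst|apply: cvgMl; exact: cvg_id].
rewrite mul0r addr0 in pq.
apply: cvg_trans pq; apply: near_eq_cvg; near=> h.
have h0 : h != 0 by near: h; exact: nbhs_dnbhs_neq.
by rewrite /= fE /GRing.scale /=; field.
Unshelve. all: by end_near. Qed.

Lemma derive_affine w (k : R) x v :
  'D_v (fun y => dotv w y + k) x = dotv w v.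
Proof.
apply: (@derive_quadratic_along _ _ _ _ 0) => h.
by rewrite dotvDr dotvZr; ring.
Qed.

Variables (A : 'M[R]_m.+1) (b : 'cV[R]_m.+1) (c : R).
Hypothesis A_sym : A^T = A.
Let f := quadratic A b c.

(** Keeping [x] as a bare argument of [dotv] makes the result visibly affine in [x], ready for
    [derive_affine]. *)
Lemma derive_quadratic x v : 'D_v f x = dotv (A *m v) x + dotv b v.
Proof.
apply: (@derive_quadratic_along _ _ _ _ (2^-1 * dotv v (A *m v))) => h.
rewrite /f /quadratic mulmxDr -scalemxAr !(dotvDr, dotvDl, dotvZl, dotvZr).
(* Symmetry of [A] merges the two cross terms, which absorbs the factor 1/2. *)
have -> : dotv x (A *m v) = dotv v (A *m x).
  by rewrite dotv_mulmx A_sym dotvC.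
have -> : dotv (A *m v) x = dotv v (A *m x) by rewrite [RHS]dotv_mulmx A_sym.
by field.
Qed.

Lemma D2_quadratic x u v : D2 f x u v = dotv u (A *m v).
Proof.
rewrite /D2 (_ : (fun y => _) = (fun y => dotv (A *m v) y + dotv b v)).
  by rewrite derive_affine dotvC.
by apply/funext => y; exact: derive_quadratic.
Qed.

Lemma D3_quadratic x u v w : D3 f x u v w = 0.
Proof.
rewrite /D3 (_ : (fun y => _) = cst (dotv v (A *m w))) ?derive_cst //.
by apply/funext => y; exact: D2_quadratic.
Qed.

Lemma hessian_quadratic x : hessian f x = A.
Proof.
apply/matrixP => i j; rewrite mxE D2_quadratic /dotv -colE trmx_delta -rowE.
by rewrite !mxE.
Qed.

End QuadraticDerivatives.

(** * Orthonormal frames as matrices *)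

Section Frame.
Variables (R : realType) (n : nat).
Implicit Types (e : 'I_n -> 'cV[R]_n.+1) (g w : 'cV[R]_n.+1).

Definition frame_mx e : 'M[R]_(n.+1, n) := \matrix_(k, i) e i k 0.

Lemma col_frame_mx e i : col i (frame_mx e) = e i.
Proof. by apply/matrixP => k j; rewrite !mxE (ord1 j). Qed.

Lemma frame_mxM e (v : 'cV[R]_n) : frame_mx e *m v = \sum_i v i 0 *: e i.
Proof.
apply/matrixP => k j; rewrite (ord1 j) mxE summxE.
by apply: eq_bigr => i _; rewrite !mxE mulrC.
Qed.

Lemma tr_frame_mxM e w i : ((frame_mx e)^T *m w) i 0 = dotv (e i) w.
Proof. by rewrite dotvE mxE; apply: eq_bigr => k _; rewrite !mxE. Qed.

Lemma frame_mx_gram e (M : 'M[R]_n.+1) i j :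
  ((frame_mx e)^T *m M *m frame_mx e) i j = dotv (e i) (M *m e j).
Proof.
rewrite -tr_frame_mxM -(col_frame_mx e j) colE !mulmxA.
by rewrite -colE [RHS]mxE.
Qed.

Lemma frame_mx_orthonormal g e :
  orthonormal_frame g e -> (frame_mx e)^T *m frame_mx e = 1%:M.
Proof.
move=> [ee _]; apply/matrixP => i j.
by rewrite -(mulmx1 (frame_mx e)^T) frame_mx_gram mul1mx ee mxE.
Qed.

(* [(u | E)] is a square matrix with orthonormal columns, so its transpose is
   also a right inverse: [u u^T + E E^T = 1]. *)
Lemma orthonormal_frame_span g e w : g != 0 -> orthonormal_frame g e ->
  (frame_mx e)^T *m w = 0 ->
  let u := (enorm g)^-1 *: g in w = dotv u w *: u.
Proof.
move=> g0 he Ew u; set E := frame_mx e in Ew.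
have gn0 : enorm g != 0 by rewrite gt_eqF ?enorm_gt0.
have uu : dotv u u = 1.
  by rewrite dotvZl dotvZr enorm_sqr //; field.
have Eu : E^T *m u = 0.
  apply/matrixP => i j; rewrite (ord1 j) tr_frame_mxM dotvZr he.2 mulr0.
  by rewrite mxE.
have uE : u^T *m E = 0 by apply: trmx_inj; rewrite trmx_mul trmxK Eu trmx0.
(* The cast uses that [1 + n] computes to [n.+1]; [mulmx1C] needs a square matrix. *)
have QQ : (row_mx u E : 'M[R]_(1 + n))^T *m row_mx u E = 1%:M.
  rewrite tr_row_mx mul_col_row trmx_mul_dotv uu Eu uE.
  by rewrite (frame_mx_orthonormal he) -scalar_mx_block.
have := mulmx1C QQ; rewrite tr_row_mx mul_row_col => QQ'.
rewrite -[LHS]mul1mx -[1%:M]QQ' mulmxDl -!mulmxA Ew mulmx0 addr0.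
by rewrite trmx_mul_dotv mul_mx_scalar.
Qed.

End Frame.

(** * The affine normal of a quadratic *)

Section QuadraticAffineNormal.
Variables (R : realType) (n : nat) (A : 'M[R]_n.+1).
Variables (b : 'cV[R]_n.+1) (c : R).
Hypothesis A_sym : A^T = A.
Let f := quadratic A b c.

Lemma affine_normal_vector_quadratic x e :
  let E := frame_mx e in let N := unit_normal f x in
  affine_normal_vector f x e =
    E *m (invmx (E^T *m A *m E) *m (E^T *m (A *m N))) - N.
Proof.
move=> E N; rewrite /affine_normal_vector.
have -> : tangent_hessian f x e = E^T *m A *m E.
  by apply/matrixP => i j; rewrite frame_mx_gram mxE D2_quadratic.
rewrite frame_mxM; congr (_ - _); apply: eq_bigr => i _; congr (_ *: _).
rewrite mxE; apply: eq_bigr => j _; congr (_ * _).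
rewrite big1 => [|p _].
  (* With the cubic term gone, symmetry turns the mixed derivative [N . A e_j] into entry [j] of
     [E^T A N]. *)
  by rewrite mulr0 oppr0 add0r D2_quadratic // tr_frame_mxM dotv_mulmx A_sym dotvC.
by rewrite big1 // => q _; rewrite D3_quadratic // mulr0.
Qed.

Lemma affine_normal_vector_newton x e :
  pos_def A -> grad f x != 0 -> orthonormal_frame (grad f x) e ->
  exists2 t : R, 0 < t &
    affine_normal_vector f x e = t *: - (invmx A *m grad f x).
Proof.
move=> A_pos g0 he; set g := grad f x in g0 he *.
rewrite affine_normal_vector_quadratic; set E := frame_mx e.
set N := unit_normal f x; set d := _ - N.
have EE : E^T *m E = 1%:M := frame_mx_orthonormal he.
(* The tangent Hessian is invertible, so [invmx] is a true inverse and not its default value. *)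
have HU := pos_def_unitmx (pos_def_congr EE A_pos).
have gn : 0 < enorm g by exact: enorm_gt0.
have EAd : E^T *m (A *m d) = 0.
  by rewrite !mulmxBr !mulmxA mulmxV // mul1mx subrr.
pose t := dotv N (A *m d).
have AdN : A *m d = t *: N := orthonormal_frame_span g0 he EAd.
have dN : dotv d N = -1.
  have EN : E^T *m N = 0.
    apply/matrixP => i j; rewrite (ord1 j) tr_frame_mxM dotvZr he.2 mulr0.
    by rewrite mxE.
  (* [d + N] lies in the range of [E], hence is orthogonal to [N]. *)
  rewrite dotvDl -scaleN1r dotvZl dotvC dotv_mulmx EN dotvC dotv0 add0r.
  rewrite /N /unit_normal -/g dotvZl dotvZr enorm_sqr //.
  by field; rewrite gt_eqF.
have d0 : d != 0.
  apply/eqP => d0; have /eqP := dN.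
  by rewrite d0 dotvC dotv0 eq_sym oppr_eq0 oner_eq0.
have tpos : 0 < - t.
  by have := A_pos _ d0; rewrite AdN dotvZr dN mulrN1.
(* From [A d = t N] and [N = g / |g|] comes [d = (t / |g|) A^-1 g]; the minus sign moves into the
   Newton direction. *)
exists (- t / enorm g); first by rewrite divr_gt0.
rewrite -[LHS](mulKmx (pos_def_unitmx A_pos)) AdN -scalemxAr.
rewrite /N /unit_normal -/g -scalemxAr scalerA.
by rewrite mulNr scaleNr scalerN opprK.
Qed.

End QuadraticAffineNormal.

Theorem theorem3p1 (R : realType) (n : nat) (hn : (1 <= n)%N)
    (A : 'M[R]_n.+1) (b : 'cV[R]_n.+1) (c : R)
    (A_sym : A^T = A) (A_pos : pos_def A) (x : 'cV[R]_n.+1) :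
  let f := quadratic A b c in
  let dN := newton_direction f x in
  dN = - (invmx A *m grad f x) /\
  (grad f x != 0 ->
     forall dAN, is_affine_normal_direction f x dAN ->
       exists2 lambda : R, 0 < lambda & dAN = lambda *: dN) /\
  (grad f x = 0 ->
     dN = 0 /\ forall dAN, is_affine_normal_direction f x dAN -> dAN = 0).
Proof.
move=> f dN.
have dNE : dN = - (invmx A *m grad f x).
  by rewrite /dN /newton_direction hessian_quadratic.
split=> //; split=> [g0 dAN|g0].
  rewrite /is_affine_normal_direction (negbTE g0) => -[e [he [mu mu0 ->]]].
  have [t t0 ->] := affine_normal_vector_newton A_sym A_pos g0 he.
  by exists (mu * t); rewrite ?mulr_gt0 // dNE scalerA.
split; first by rewrite dNE g0 mulmx0 oppr0.
by move=> dAN; rewrite /is_affine_normal_direction g0 eqxx.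
Qed.
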